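(* Let $(G,+)$ be a group (not necessarily abelian) with identity $0_G$, let $R$ be a reflexive relation on $G$, and let $A,B$ be nonempty subsets of $G$. Assume that $R$ is transitive and isotone and satisfies property (P4) (relative to $B$). If $A$ is finite and $B=\{b\}$ with $bI0_G$, then $\mathscr{E}(A+B)\neq\mathscr{E}(A)$.
   Context: For $x,y\in G$, $xPy$ means that $xRy$ holds and $yRx$ does not; $xIy$ means that neither $xRy$ nor $yRx$ holds. $R$ is isotone if for all $g,g',z\in G$, $gRg'$ implies $(z+g)R(z+g')$ and $(g+z)R(g'+z)$. For an integer $p\geq 1$ and $g\in G$, $pg$ is the sum of $p$ copies of $g$. Property (P4): for every $m\geq 1$, all integers $p_1,\dots,p_m\geq 1$ and all $b^1,\dots,b^m\in B$, $(p_1b^1+\dots+p_mb^m)R0_G$ implies that at least one $b^l$ satisfies $b^lR0_G$. The sum set is $A+B=\{a+b: a\in A, b\in B\}$. For $S\subseteq G$, $\mathscr{E}(S)$ is the set of efficient points of $S$, i.e. of those $g\in S$ for which there is no $g'\in S$ with $g'Pg$; by convention $\mathscr{E}(\emptyset)=\emptyset$. *)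

(* Defs.v *)
(* A not necessarily abelian group is a [groupType], whose
   law is multiplicative: the additive notation reads as

      x + y  ~>  (x * y)%g        0_G  ~>  1%g        p g  ~>  (g ^+ p)%g

   Subsets of G are classical sets [set G] and relations are Prop-valued, so
   no decidability is assumed.  *)
From Corelib Require Export RelationClasses.
From mathcomp Require Export all_boot.
From mathcomp Require Export boolp classical_sets cardinality.

Set Implicit Arguments.
Unset Strict Implicit.
Unset Printing Implicit Defensive.

Local Open Scope classical_set_scope.
Local Open Scope group_scope.

Definition strict_pref (G : Type) (R : G -> G -> Prop) (x y : G) : Prop :=
  R x y /\ ~ R y x.

Definition incomparable (G : Type) (R : G -> G -> Prop) (x y : G) : Prop :=
  ~ R x y /\ ~ R y x.

Definition isotone (G : groupType) (R : G -> G -> Prop) : Prop :=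
  forall g g' z : G, R g g' -> R (z * g) (z * g') /\ R (g * z) (g' * z).

(* The iterated product is taken in increasing order of l; the b l need be
   neither distinct nor commuting. *)
Definition P4 (G : groupType) (R : G -> G -> Prop) (B : set G) : Prop :=
  forall (m : nat) (p : 'I_m -> nat) (b : 'I_m -> G),
    (1 <= m)%N ->
    (forall l, (1 <= p l)%N) ->
    (forall l, B (b l)) ->
    R (\prod_(l < m) b l ^+ p l) 1 ->
    exists l, R (b l) 1.

Definition sumset (G : groupType) (A B : set G) : set G :=
  [set a * b | a in A & b in B].

Definition efficient (G : Type) (R : G -> G -> Prop) (S : set G) : set G :=
  [set g | S g /\ ~ exists2 g', S g' & strict_pref R g' g].

(* Main.v *)
Require Import Defs.

Set Implicit Arguments.
Unset Strict Implicit.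
Unset Printing Implicit Defensive.

(** Right translation by [b] is an automorphism of [R], so the efficient points
    of [A + b] are the translates by [b] of the efficient points of [A].  If
    both sets of efficient points coincided, [efficient R A] would be stable
    under [a |-> a * b].  It is nonempty because [A] is finite and nonempty and
    strict preference is a strict order, hence it would contain a whole orbit
    [a, a * b, a * b ^+ 2, ...].  By reflexivity, (P4) prevents [b] from having
    finite order: [b ^+ p = 1] gives [R (b ^+ p) 1], hence [R b 1], against
    incomparability.  The orbit is therefore infinite, while [A] is finite. *)

Local Open Scope classical_set_scope.
Local Open Scope group_scope.

(** Induction on an enumeration: a new element either strictly dominates the
    efficient point found so far, and then transitivity shows that nothing
    dominates it, or it leaves that point efficient. *)
Lemma finite_efficient_neq0 (T : choiceType) (R : T -> T -> Prop) (A : set T) :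
  Transitive R -> finite_set A -> A !=set0 -> efficient R A !=set0.
Proof.
move=> R_trans /finite_seqP[s ->{A}].
elim: s => [[x //]|a s IHs _].
have [/IHs[m [ms m_max]]|s0] := pselect ([set` s] !=set0); last first.
  exists a; split=> [|[y /=]]; first exact: mem_head.
  rewrite inE => /predU1P[-> [] //|ys _].
  by case: s0; exists y.
have [[Ram nRma]|nPam] := pselect (strict_pref R a m).
  exists a; split=> [|[y /=]]; first exact: mem_head.
  rewrite inE => /predU1P[-> [] //|ys [Rya _]].
  apply: m_max; exists y => //; split; first exact: R_trans Ram.
  by move=> Rmy; apply: nRma; exact: R_trans Rya.
exists m; split=> [|[y /=]]; first by rewrite /= inE ms orbT.
rewrite inE => /predU1P[-> //|ys Pym].
by apply: m_max; exists y.
Qed.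

(** Cancellation, the converse of isotonicity, is isotonicity for [z^-1]. *)
Lemma isotone_mul2r (G : groupType) (R : G -> G -> Prop) (z x y : G) :
  isotone R -> R (x * z) (y * z) <-> R x y.
Proof.
move=> R_iso; split=> [/(R_iso _ _ z^-1)[_]|/(R_iso _ _ z)[]//].
by rewrite !mulgK.
Qed.

Lemma strict_pref_mul2r (G : groupType) (R : G -> G -> Prop) (z x y : G) :
  isotone R -> strict_pref R (x * z) (y * z) <-> strict_pref R x y.
Proof. by move=> R_iso; rewrite /strict_pref !isotone_mul2r. Qed.

Lemma efficient_translate (G : groupType) (R : G -> G -> Prop) (A : set G)
    (b a : G) :
  isotone R -> efficient R A a -> efficient R (sumset A [set b]) (a * b).
Proof.
move=> R_iso [Aa a_max]; split; first by exists a => //; exists b.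
move=> [_ [a' Aa' [_ -> <-]] /(strict_pref_mul2r _ _ _ R_iso) Pa'a].
by apply: a_max; exists a'.
Qed.

Lemma P4_expg_neq1 (G : groupType) (R : G -> G -> Prop) (b : G) :
  Reflexive R -> P4 R [set b] -> ~ R b 1 ->
  forall p, (0 < p)%N -> b ^+ p <> 1.
Proof.
move=> R_refl R_P4 nRb1 p p_gt0 bp1; apply: nRb1.
have [||||//] := R_P4 1%N (fun=> p) (fun=> b) => //.
by rewrite big_ord1 bp1.
Qed.

Lemma expg_inj_infinite_order (G : groupType) (b : G) :
  (forall p, (0 < p)%N -> b ^+ p <> 1) -> injective (fun n => b ^+ n).
Proof.
move=> b_inf i j; wlog lt_ij : i j / (i < j)%N => [wlog_lt|] /=.
  by case: (ltngtP i j) => // [/wlog_lt//|/wlog_lt ji /esym/ji].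
rewrite -(subnKC (ltnW lt_ij)) expgnDr -[LHS]mulg1 => /mulgI/esym.
by move/b_inf; rewrite subn_gt0 => /(_ lt_ij).
Qed.

Theorem theorem7 (G : groupType) (R : G -> G -> Prop) (A B : set G) (b : G)
    (R_refl : Reflexive R)
    (A_neq0 : A !=set0) (B_neq0 : B !=set0)
    (R_trans : Transitive R) (R_iso : isotone R) (R_P4 : P4 R B)
    (A_fin : finite_set A) (B_eq : B = [set b]) (bI0 : incomparable R b 1) :
  efficient R (sumset A B) <> efficient R A.
Proof.
subst B => eqE.
have [a Ea] := finite_efficient_neq0 R_trans A_fin A_neq0.
have Eab n : efficient R A (a * b ^+ n).
  elim: n => [|n IHn]; first by rewrite expg0 mulg1.
  by rewrite expgSr mulgA -eqE; exact: efficient_translate.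
have orbit_inj : injective (fun n => a * b ^+ n).
  move=> i j /mulgI; apply: expg_inj_infinite_order.
  by apply: P4_expg_neq1 R_refl R_P4 _; case: bI0.
apply: infinite_nat.
have -> : [set: nat] = (fun n => a * b ^+ n) @^-1` A.
  by apply/seteqP; split=> n //= _; case: (Eab n).
by apply: finite_preimage A_fin => i j _ _; exact: orbit_inj.
Qed.
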